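(* For every integer $k\geq 3$ there exists a language $L$ (over some finite alphabet) that is accepted by some $k$-letter group finite automaton but is not accepted by any $(k-1)$-letter group finite automaton.
   Context: Let $k\geq 1$. A $k$-letter deterministic finite automaton ($k$-letter DFA) is a quintuple $(Q,Q_{acc},q_0,\Sigma,\gamma)$, where $Q$ is a finite set of states, $Q_{acc}\subseteq Q$ is the set of accepting states, $q_0\in Q$ is the initial state, $\Sigma$ is a finite input alphabet, and $\gamma: Q\times T^k\to Q$ is the transition function, where $T=\{\Lambda\}\cup\Sigma$, $\Lambda\notin\Sigma$ is a blank symbol, and $T^k$ is the set of strings of length $k$ over $T$. Computation on $x=\sigma_1\sigma_2\cdots\sigma_m\in\Sigma^*$: put $\sigma_j=\Lambda$ for $j\leq 0$. The automaton starts in $q_0$, and at step $i$ ($i=1,\ldots,m$) it passes from its current state $q$ to $\gamma(q,\sigma_{i-k+1}\sigma_{i-k+2}\cdots\sigma_i)$, i.e. each transition depends on the last $k$ letters received (padded on the left by blanks). The string $x$ is accepted iff the state after step $m$ belongs to $Q_{acc}$. The automaton accepts the language $L\subseteq\Sigma^*$ if $L$ is exactly the set of accepted strings. A $k$-letter DFA is a $k$-letter group finite automaton ($k$-letter GFA) iff for every $w\in T^k$ the map $q\mapsto\gamma(q,w)$ is a bijection from $Q$ to $Q$. *)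

(* Defs.v *)
From mathcomp Require Import all_boot.

Set Implicit Arguments.
Unset Strict Implicit.
Unset Printing Implicit Defensive.

(* Tape letters are [option Sigma]; [None] is the blank Lambda.  Automata are
   meant for k >= 1, although k = 0 is not excluded by the type. *)
Record kdfa (k : nat) (Sigma : finType) := KDFA {
  kdfa_state : finType;
  kdfa_acc : {set kdfa_state};
  kdfa_init : kdfa_state;
  kdfa_trans : kdfa_state -> k.-tuple (option Sigma) -> kdfa_state
}.

(* For 1 <= i <= size x, the string sigma_(i-k+1) ... sigma_i, where x is
   sigma_1 ... sigma_m and sigma_j is blank for j <= 0: letter sigma_j sits at
   index j + k - 1 of x padded on the left by k blanks. *)
Definition kwindow (k : nat) (Sigma : finType) (x : seq Sigma) (i : nat) :
    k.-tuple (option Sigma) :=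
  [tuple nth None (nseq k None ++ map Some x) (i + p) | p < k].

Section Computation.
Variables (k : nat) (Sigma : finType) (A : kdfa k Sigma).

Fixpoint kdfa_run (x : seq Sigma) (i : nat) : kdfa_state A :=
  if i is j.+1 then kdfa_trans (kdfa_run x j) (kwindow k x i)
  else kdfa_init A.

Definition kdfa_accepts_word (x : seq Sigma) : bool :=
  kdfa_run x (size x) \in kdfa_acc A.

Definition kdfa_accepts (L : seq Sigma -> Prop) : Prop :=
  forall x : seq Sigma, L x <-> kdfa_accepts_word x.

Definition is_kgfa : Prop :=
  forall w : k.-tuple (option Sigma),
    bijective (fun q : kdfa_state A => kdfa_trans q w).

End Computation.

Definition kgfa_language (k : nat) (Sigma : finType) (L : seq Sigma -> Prop)
    : Prop :=
  exists A : kdfa k Sigma, is_kgfa A /\ kdfa_accepts A L.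

(* Main.v *)
(** Over the letters a = [true] and b = [false], count modulo 2 the factors
    a^(k-1) b: this takes a window of length k. In a (k-1)-letter group
    automaton, once a^(k-2) has been read, each further a acts by the same
    permutation g, the one of the window a^(k-1). Hence for N the length of the
    g-cycle of the state reached, a^(k-2) and a^(k-2+N) lead to the same state,
    and the last k-1 letters of a^(k-2) b and a^(k-2+N) b coincide, so that
    these two words are not told apart; but only the second one contains
    a^(k-1) b. *)
Require Import Defs.
From mathcomp Require Import all_boot.
From mathcomp Require Import zify.

Definition true_block (m : nat) : seq bool := rcons (nseq m true) false.

Lemma size_true_block m : size (true_block m) = m.+1.
Proof. by rewrite size_rcons size_nseq. Qed.

Lemma nth_padded_true_block k m t :
  nth None (nseq k None ++ map Some (true_block m)) t =
  if t < k then None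
  else if t < k + m then Some true
  else if t == k + m then Some false else None.
Proof.
rewrite nth_cat size_nseq nth_nseq; case: ltnP => // le_kt.
rewrite map_rcons nth_rcons map_nseq size_nseq nth_nseq.
have -> : (t - k < m) = (t < k + m) by lia.
have -> : (t - k == m) = (t == k + m) by lia.
by case: ifP => // ->.
Qed.

Lemma tnth_kwindow_true_block k m i (p : 'I_k) :
  tnth (kwindow k (true_block m) i) p =
  if i + p < k then None
  else if i + p < k + m then Some true
  else if i + p == k + m then Some false else None.
Proof. by rewrite tnth_mktuple nth_padded_true_block. Qed.

Definition parity_dfa (k : nat) (Sigma : finType)
    (w : k.-tuple (option Sigma)) : kdfa k Sigma :=
  KDFA [set true] false (fun q v => q (+) (v == w)).

(** Each window acts on the two states as the identity or as the swap, hence as an involution. *)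
Lemma parity_dfa_is_kgfa k (Sigma : finType) (w : k.-tuple (option Sigma)) :
  is_kgfa (parity_dfa _ _ w).
Proof.
by move=> v; exists (fun q : bool => q (+) (v == w)) => q; apply: addbK.
Qed.

Lemma parity_dfa_run_false k (Sigma : finType) (w : k.-tuple (option Sigma)) x n :
  (forall i, 0 < i <= n -> kwindow k x i != w) ->
  kdfa_run (parity_dfa _ _ w) x n = false.
Proof.
elim: n => [//|n IHn] xw /=.
rewrite IHn; first by apply/negbTE/xw; rewrite leqnn.
by move=> i /andP[i0 le_in]; apply: xw; rewrite i0 leqW.
Qed.

Lemma kgfa_true_block_pump n (B : kdfa n.+1 bool) : is_kgfa B ->
  exists2 N, 0 < N &
    kdfa_accepts_word B (true_block (n + N)) =
    kdfa_accepts_word B (true_block n).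
Proof.
move=> gB; pose a_window := [tuple of nseq n.+1 (Some true)].
pose g (q : kdfa_state B) := kdfa_trans q a_window.
have g_inj : injective g by apply: bij_inj; apply: gB.
pose q0 := kdfa_run B (true_block n) n.
exists (order g q0); first exact: order_gt0.
set N := order g q0.
(* Up to step [n] both words show only a's, behind the same blanks. *)
have run_prefix i : i <= n ->
    kdfa_run B (true_block (n + N)) i = kdfa_run B (true_block n) i.
  elim: i => [//|i IHi] lt_in; rewrite /= IHi ?(ltnW lt_in) //; congr kdfa_trans.
  apply: eq_from_tnth => p; rewrite !tnth_kwindow_true_block.
  have lt_p := ltn_ord p.
  case: ifP => // _.
  by rewrite !ifT //; lia.
(* For [j < N] the window at step [n + j + 1] spans letters [j + 1] to [n + j + 1], past all blanks
   and before b, so it acts as [g]. *)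
have run_iter j : j <= N ->
    kdfa_run B (true_block (n + N)) (n + j) = iter j g q0.
  elim: j => [|j IHj] lt_jN; first by rewrite addn0 run_prefix.
  rewrite addnS /= IHj ?(ltnW lt_jN) //; congr kdfa_trans.
  apply: eq_from_tnth => p; rewrite tnth_kwindow_true_block (tnth_nth None).
  have lt_p := ltn_ord p.
  by rewrite nth_nseq lt_p ifF ?ifT //; lia.
(* After the full [g]-cycle both runs stand in [q0] and read the same last window a^n b. *)
rewrite /kdfa_accepts_word !size_true_block /= run_iter // iter_order //.
rewrite -/q0; congr (kdfa_trans q0 _ \in kdfa_acc B).
apply: eq_from_tnth => p; rewrite !tnth_kwindow_true_block.
have lt_p := ltn_ord p.
rewrite [in LHS]ifF; last lia.
rewrite [in RHS]ifF; last lia.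
have -> : ((n + N).+1 + p < n.+1 + (n + N)) = (n.+1 + p < n.+1 + n) by lia.
by have -> : ((n + N).+1 + p == n.+1 + (n + N)) = (n.+1 + p == n.+1 + n) by lia.
Qed.

Theorem theorem3 (k : nat) (hk : 3 <= k) :
  exists (Sigma : finType) (L : seq Sigma -> Prop),
    kgfa_language k L /\ ~ kgfa_language k.-1 L.
Proof.
case: k hk => [//|[//|n]] _ /=.
(* The last window of a^(n+1) b is that word itself, without blanks. *)
pose w := kwindow n.+2 (true_block n.+1) n.+2.
pose A := parity_dfa _ _ w.
exists bool, (fun x => kdfa_accepts_word A x); split.
  by exists A; split=> //; apply: parity_dfa_is_kgfa.
case=> B [/kgfa_true_block_pump[N N_gt0 eqB] accB].
(* With only [n + 1] letters in a^n b, each window starts with a blank, whereas [w] starts with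
   a. *)
have short : ~~ kdfa_accepts_word A (true_block n).
  rewrite /kdfa_accepts_word parity_dfa_run_false ?inE // => i.
  rewrite size_true_block => /andP[_ le_in].
  apply/eqP => /(congr1 (fun v => tnth v ord0)).
  by rewrite !tnth_kwindow_true_block /= !addn0 !ltnn ifT // ifT //; lia.
(* As [N > 0], the last window is a^(n+1) b and flips the state exactly once. *)
have long : kdfa_accepts_word A (true_block (n + N)).
  rewrite /kdfa_accepts_word size_true_block /= parity_dfa_run_false /=.
    rewrite inE eqb_id; apply/eqP/eq_from_tnth => p.
    rewrite !tnth_kwindow_true_block.
    have lt_p := ltn_ord p.
    rewrite [in LHS]ifF; last lia.
    rewrite [in RHS]ifF; last lia.
    have -> : ((n + N).+1 + p < n.+2 + (n + N)) = (n.+2 + p < n.+2 + n.+1) by lia.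
    by have -> : ((n + N).+1 + p == n.+2 + (n + N)) = (n.+2 + p == n.+2 + n.+1)
      by lia.
  (* Every earlier window ends with a, whereas [w] ends with b. *)
  move=> i /andP[i_gt0 le_i].
  apply/eqP => /(congr1 (fun v => tnth v ord_max)).
  rewrite !tnth_kwindow_true_block /=.
  rewrite [in LHS]ifF; last lia.
  rewrite [in LHS]ifT; last lia.
  by rewrite ltnn eqxx ifF //; lia.
by move/negP: short; apply; apply/accB; rewrite -eqB; apply/accB.
Qed.
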